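(* Let $(X,d,W)$ be a $W$-hyperbolic space, $C\subseteq X$ a convex subset, $T:C\to C$ a nonexpansive mapping with $Fix(T)\neq\emptyset$, $x_0,u\in C$, $(\lambda_n)_{n\in\mathbb N}$, $(\beta_n)_{n\in\mathbb N}$ sequences in $[0,1]$, and let $(x_n)$ be the Tikhonov-Mann iteration $x_{n+1}=(1-\lambda_n)u_n+\lambda_n Tu_n$, where $u_n=(1-\beta_n)u+\beta_n x_n$. Let $\sigma_1,\sigma_3,\sigma_4:\mathbb N\to\mathbb N$ be such that: - $\sum_{n=0}^\infty(1-\beta_n)$ diverges with rate of divergence $\sigma_1$; - $\sum_{n=0}^\infty|\beta_{n+1}-\beta_n|$ converges with Cauchy modulus $\sigma_3$; - $\sum_{n=0}^\infty|\lambda_{n+1}-\lambda_n|$ converges with Cauchy modulus $\sigma_4$. Let $p\in Fix(T)$, $M=\max\{d(x_0,p),d(u,p)\}$, and let $K\in\mathbb N^*$ be such that $K\ge M$. Define $\chi:\mathbb N\to\mathbb N$ by $\chi(k)=\max\{\sigma_3(8K(k+1)-1),\ \sigma_4(8K(k+1)-1)\}$. Then the following hold: (i) $(x_n)$ is asymptotically regular with rate of asymptotic regularity $$\Sigma(k)=\sigma_1\big(\chi(3k+2)+2+\lceil\ln(6K(k+1))\rceil\big)+1.$$ (ii) If, furthermore, $\lim_{n\to\infty}\beta_n=1$ with rate of convergence $\sigma_5:\mathbb N\to\mathbb N$, and $\Lambda\in\mathbb N^*$, $N_\Lambda\in\mathbb N$ are such that $\lambda_n\ge\frac1\Lambda$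 for all $n\ge N_\Lambda$, then $(x_n)$ is $T$-asymptotically regular with rate of $T$-asymptotic regularity $$\Phi(k)=\max\{N_\Lambda,\ \Sigma(2\Lambda(k+1)-1),\ \sigma_5(4K\Lambda(k+1)-1)\}.$$
   Context: A $W$-hyperbolic space is a triple $(X,d,W)$ where $(X,d)$ is a metric space and $W:X\times X\times[0,1]\to X$ is a function, with $W(x,y,\lambda)$ denoted by $(1-\lambda)x+\lambda y$, such that for all $x,y,z,w\in X$ and $\lambda,\tilde\lambda\in[0,1]$: (W1) $d(z,W(x,y,\lambda))\le(1-\lambda)d(z,x)+\lambda d(z,y)$; (W2) $d(W(x,y,\lambda),W(x,y,\tilde\lambda))=|\lambda-\tilde\lambda|d(x,y)$; (W3) $W(x,y,\lambda)=W(y,x,1-\lambda)$; (W4) $d(W(x,z,\lambda),W(y,w,\lambda))\le(1-\lambda)d(x,y)+\lambda d(z,w)$. A nonempty $C\subseteq X$ is convex if $W(x,y,\lambda)\in C$ for all $x,y\in C$, $\lambda\in[0,1]$. Thus $u_n=W(u,x_n,\beta_n)$ and $x_{n+1}=W(u_n,Tu_n,\lambda_n)$. $T:C\to C$ is nonexpansive if $d(Tx,Ty)\le d(x,y)$ for all $x,y\in C$; $Fix(T)$ is its set of fixed points. $\mathbb N=\{0,1,2,\dots\}$, $\mathbb N^*=\mathbb N\setminus\{0\}$. For a sequence $(a_n)$ in a metric space and $\varphi:\mathbb N\to\mathbb N$: $\varphi$ is a rate of convergence of $(a_n)$ towards $a$ if for all $k\in\mathbb N$ and $n\ge\varphi(k)$,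 $d(a_n,a)\le\frac1{k+1}$; $\varphi$ is a Cauchy modulus of $(a_n)$ if for all $k\in\mathbb N$, $n\ge\varphi(k)$ and $p\in\mathbb N$, $d(a_{n+p},a_n)\le\frac1{k+1}$. For nonnegative reals $b_n$: a rate of divergence of a divergent series $\sum b_n$ is $\theta:\mathbb N\to\mathbb N$ with $\sum_{i=0}^{\theta(n)}b_i\ge n$ for all $n\in\mathbb N$; a Cauchy modulus of a convergent series $\sum b_n$ is a Cauchy modulus of its sequence of partial sums $\left(\sum_{i=0}^n b_i\right)_n$. $(x_n)$ is asymptotically regular if $d(x_n,x_{n+1})\to0$, and a rate of asymptotic regularity is a rate of convergence of $(d(x_n,x_{n+1}))$ towards $0$. $(x_n)$ is $T$-asymptotically regular if $d(x_n,Tx_n)\to0$, and a rate of $T$-asymptotic regularity is a rate of convergence of $(d(x_n,Tx_n))$ towards $0$. *)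

(* Defs.v *)
From HB Require Import structures.
From mathcomp Require Import all_boot all_order all_algebra.
From mathcomp Require Import all_classical all_reals all_analysis.
Set Implicit Arguments.
Unset Strict Implicit.
Unset Printing Implicit Defensive.
Import Order.TTheory GRing.Theory Num.Theory.
Import numFieldNormedType.Exports.
Local Open Scope classical_set_scope.
Local Open Scope ring_scope.

(* [W x y l] stands for (1 - l) x + l y.  The third argument of [W] ranges over
   [R], but only its values for 0 <= l <= 1 are constrained or used. *)
Record Whyperbolic (R : realType) (X : metricType R) (W : X -> X -> R -> X)
    : Prop := {
  W1 : forall (x y z : X) (l : R), 0 <= l <= 1 ->
    mdist z (W x y l) <= (1 - l) * mdist z x + l * mdist z y ;
  W2 : forall (x y : X) (l l' : R), 0 <= l <= 1 -> 0 <= l' <= 1 ->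
    mdist (W x y l) (W x y l') = `|l - l'| * mdist x y ;
  W3 : forall (x y : X) (l : R), 0 <= l <= 1 -> W x y l = W y x (1 - l) ;
  W4 : forall (x y z w : X) (l : R), 0 <= l <= 1 ->
    mdist (W x z l) (W y w l) <= (1 - l) * mdist x y + l * mdist z w }.

Definition Wconvex (R : realType) (X : metricType R) (W : X -> X -> R -> X)
    (C : set X) : Prop :=
  C !=set0 /\
  forall (x y : X) (l : R), C x -> C y -> 0 <= l <= 1 -> C (W x y l).

Definition nonexpansive_on (R : realType) (X : metricType R) (C : set X)
    (T : X -> X) : Prop :=
  forall x y : X, C x -> C y -> mdist (T x) (T y) <= mdist x y.

Definition Fix (X : Type) (C : set X) (T : X -> X) : set X :=
  [set p | C p /\ T p = p].

Section rates.
Context {R : realType}.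

Definition rate_of_convergence (X : metricType R) (a : nat -> X) (l : X)
    (phi : nat -> nat) : Prop :=
  forall k n : nat, (phi k <= n)%N -> mdist (a n) l <= k.+1%:R^-1.

Definition cauchy_modulus (X : metricType R) (a : nat -> X)
    (phi : nat -> nat) : Prop :=
  forall k n p : nat, (phi k <= n)%N ->
    mdist (a (n + p)%N) (a n) <= k.+1%:R^-1.

(* The terms up to and including [b n]; [series b n] stops at [b n.-1]. *)
Definition partial_sums (b : nat -> R) : nat -> R^o :=
  fun n => series b n.+1.

Definition rate_of_divergence (b : nat -> R) (theta : nat -> nat) : Prop :=
  forall n : nat, n%:R <= partial_sums b (theta n).

Definition series_diverges_with (b : nat -> R) (theta : nat -> nat) : Prop :=
  ~ cvgn (partial_sums b) /\ rate_of_divergence b theta.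

Definition series_converges_with (b : nat -> R) (phi : nat -> nat) : Prop :=
  cvgn (partial_sums b) /\ cauchy_modulus (partial_sums b) phi.

Definition converges_with (X : metricType R) (a : nat -> X) (l : X)
    (phi : nat -> nat) : Prop :=
  a @ \oo --> l /\ rate_of_convergence a l phi.

Definition asymptotically_regular_with (X : metricType R) (x : nat -> X)
    (phi : nat -> nat) : Prop :=
  converges_with ((fun n => mdist (x n) (x n.+1)) : nat -> R^o) 0 phi.

Definition T_asymptotically_regular_with (X : metricType R) (T : X -> X)
    (x : nat -> X) (phi : nat -> nat) : Prop :=
  converges_with ((fun n => mdist (x n) (T (x n))) : nat -> R^o) 0 phi.

End rates.

Fixpoint tikhonov_mann (R : realType) (X : metricType R) (W : X -> X -> R -> X)
    (T : X -> X) (u x0 : X) (lam beta : nat -> R) (n : nat) : X :=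
  if n is m.+1 then
    let um := W u (tikhonov_mann W T u x0 lam beta m) (beta m) in
    W um (T um) (lam m)
  else x0.

Definition ceil_ln (R : realType) (m : nat) : nat :=
  (* for [0 < m] the ceiling is nonnegative, so the absolute value is a mere
     cast from [int] to [nat] *)
  `|Num.ceil (ln (m%:R : R))|%N.

(* Main.v *)
Require Import Defs.
From HB Require Import structures.
From mathcomp Require Import all_boot all_order all_algebra.
From mathcomp Require Import all_classical all_reals all_analysis.
From mathcomp Require Import ring lra zify.
Set Implicit Arguments.
Unset Strict Implicit.
Unset Printing Implicit Defensive.
Import Order.TTheory GRing.Theory Num.Theory.
Import numFieldNormedType.Exports.
Local Open Scope classical_set_scope.
Local Open Scope ring_scope.

(** The iterates and the anchored points [u_n = (1 - beta_n) u + beta_n x_n] never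
    leave the ball around the fixed point [p] whose radius [M] bounds
    [d (x_0, p)] and [d (u, p)]: balls are convex
    by (W1), and a nonexpansive map does not move a point away from its fixed
    point.  All the distances between [u], [x_n], [u_n] and [T u_n] are
    therefore at most [2 M].

    Asymptotic regularity comes from a perturbed contraction
    (lemma [tikhonov_mann_step]).  Two consecutive steps are convex
    combinations with slightly different coefficients; (W4) compares them when
    the coefficients agree, (W2) pays [2 M] times the change of coefficient.
    The steps [s_n = d (x_n, x_{n+1})] thus satisfy
    [s_{n+1} <= beta_{n+1} s_n + c_n], where
    [c_n = 2 M (|beta_{n+1} - beta_n| + |lam_{n+1} - lam_n|)].
    Iterating from an index [N], and using [beta <= exp (- (1 - beta))], gives
    [s_n <= exp (- \sum_i (1 - beta_i)) s_N + \sum_i c_i]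
    (lemma [contraction_recurrence_bound]).  The second sum is a tail of a
    convergent series, made small by [sigma3] and [sigma4]; the exponent is
    made large by [sigma1] (lemma [contraction_recurrence_rate]).

    For the residual [d (x_n, T x_n)], the triangle inequality through
    [x_{n+1}] produces [(1 - lam_n) d (x_n, T x_n)] on the right-hand side.
    Absorbing it leaves
    [lam_n d (x_n, T x_n) <= s_n + 2 M (1 - beta_n)]
    (lemma [tikhonov_mann_residual]), and the lower bound on [lam_n] permits the
    division. *)

(** * Rates of convergence and of divergence *)

Lemma mdist_absE (R : realType) (a b : R^o) : mdist a b = `|a - b|.
Proof. by rewrite distrC. Qed.

(** Reduces convergence to its quantitative form, so that only rates have to be
    established. *)
Lemma rate_of_convergence_cvg (R : realType) (X : metricType R) (a : nat -> X)
  (l : X) (phi : nat -> nat) :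
  rate_of_convergence a l phi -> a @ \oo --> l.
Proof.
move=> rate; apply/cvg_ballP => e e0.
have [k _ kP] := near_infty_natSinv_lt (PosNum e0).
exists (phi k) => // n /= kn; rewrite ballEmdist /= metric_sym.
exact: le_lt_trans (rate k n kn) (kP k (leqnn k)).
Qed.

Lemma converges_with0 (R : realType) (s : nat -> R) (phi : nat -> nat) :
  (forall n, 0 <= s n) ->
  (forall k n, (phi k <= n)%N -> s n <= k.+1%:R^-1) ->
  converges_with (s : nat -> R^o) 0 phi.
Proof.
move=> s0 rate.
suff r : rate_of_convergence (s : nat -> R^o) 0 phi.
  by split=> //; exact: rate_of_convergence_cvg r.
by move=> k n kn; rewrite mdist_absE subr0 ger0_norm // rate.
Qed.

Lemma expR_ceil_ln (R : realType) (m : nat) : (0 < m)%N ->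
  expR (- (ceil_ln R m)%:R) <= m%:R^-1 :> R.
Proof.
move=> m0; rewrite expRN lef_pV2 ?posrE ?expR_gt0 ?ltr0n //.
rewrite -[leLHS](@lnK R) ?posrE ?ltr0n // ler_expR.
apply: le_trans (ceil_ge _) _; rewrite /ceil_ln natr_absz ler_int.
exact: ler_norm.
Qed.

(** [partial_sums b n] includes [b n], so the modulus controls tails that
    start at [n.+1]. *)
Lemma sum_tail_le (R : realType) (b : nat -> R) (phi : nat -> nat) (k n m : nat) :
  cauchy_modulus (partial_sums b) phi -> (phi k <= n)%N ->
  \sum_(n.+1 <= i < n.+1 + m) b i <= k.+1%:R^-1.
Proof.
move=> cau kn; have := cau k n m kn.
rewrite mdist_absE /partial_sums -addSn addnC series_addn addrC addKr.
exact/le_trans/ler_norm.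
Qed.

Lemma partial_sums_le_mono (R : realType) (b : nat -> R) (n m : nat) :
  (forall i, 0 <= b i) -> (n <= m)%N -> partial_sums b n <= partial_sums b m.
Proof. by move=> b0 nm; apply: nondecreasing_series. Qed.

Lemma series_le_nat (R : realType) (b : nat -> R) (n : nat) :
  (forall i, b i <= 1) -> series b n <= n%:R.
Proof.
move=> b1; rewrite seriesEnat /=.
apply: (@le_trans _ _ (\sum_(0 <= i < n) (1 : R))); first exact: ler_sum.
by rewrite sumr_const_nat subn0.
Qed.

(** The first [N] terms contribute at most [N], so a partial sum that reaches
    [N + L] owes at least [L] to the later terms.  Since no term exceeds [1], such
    a partial sum has at least [N + L] terms, which puts [n] past [N]. *)
Lemma sum_ge_rate_of_divergence (R : realType) (b : nat -> R)
    (theta : nat -> nat) (N L n : nat) :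
  (forall i, 0 <= b i <= 1) -> rate_of_divergence b theta ->
  (theta (N + L) <= n)%N ->
  (N + L <= n.+1)%N /\ L%:R <= \sum_(N <= i < n.+1) b i.
Proof.
move=> b01 div thn.
have big : (N + L)%:R <= partial_sums b n.
  apply: le_trans (div _) _; apply: partial_sums_le_mono => // i.
  by case/andP: (b01 i).
have NLn : (N + L <= n.+1)%N.
  rewrite -(ler_nat R); apply: le_trans big _.
  by apply: series_le_nat => i; case/andP: (b01 i).
split=> //; have Nn : (N <= n.+1)%N by exact: leq_trans (leq_addr _ _) NLn.
have small : series b N <= N%:R.
  by apply: series_le_nat => i; case/andP: (b01 i).
have := sub_series_geq b Nn; rewrite -/(partial_sums b n) => <-.
by rewrite natrD in big; lra.
Qed.

(** * Perturbed contractions *)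

(** Unfolding the recurrence gives the product of the [1 - a i], bounded here by
    an exponential, plus the perturbations, whose contraction factors are
    dropped. *)
Lemma contraction_recurrence_bound (R : realType) (s a c : nat -> R) (n m : nat) :
  (forall i, 0 <= a i <= 1) -> (forall i, 0 <= s i) -> (forall i, 0 <= c i) ->
  (forall i, s i.+1 <= (1 - a i) * s i + c i) ->
  s (n + m)%N <= expR (- \sum_(n <= i < n + m) a i) * s n
                 + \sum_(n <= i < n + m) c i.
Proof.
move=> a01 s0 c0 rec; elim: m => [|m IHm].
  by rewrite addn0 !big_geq // oppr0 expR0 mul1r addr0.
rewrite addnS !big_nat_recr ?leq_addr //= addrA.
apply: le_trans (rec _) _; rewrite lerD2r.
case/andP: (a01 (n + m)%N) => a0 a1.
apply: le_trans (ler_wpM2l _ IHm) _; first by rewrite subr_ge0.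
rewrite mulrDr lerD //; last first.
  by rewrite ler_piMl ?sumr_ge0 // lerBlDr lerDl.
rewrite opprD expRD mulrA ler_wpM2r // mulrC ler_wpM2l ?expR_ge0 //.
exact: expR_ge1Dx.
Qed.

(** The contraction starts at index [N.+1], the first one whose perturbations
    lie in the controlled tail.  Since step [i] contracts by [1 - b i.+1], the
    exponent sums [b] from [N + 2] on, hence the argument [N + 2 + L] of
    [theta]. *)
Lemma contraction_recurrence_rate (R : realType) (s b c : nat -> R)
    (theta : nat -> nat) (D eps : R) (N L n : nat) :
  (forall i, 0 <= b i <= 1) -> rate_of_divergence b theta ->
  (forall i, 0 <= c i) -> (forall i, 0 <= s i <= D) ->
  (forall i, s i.+1 <= (1 - b i.+1) * s i + c i) ->
  (forall m, \sum_(N.+1 <= i < N.+1 + m) c i <= eps) ->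
  (theta (N + 2 + L) <= n)%N ->
  s n <= expR (- L%:R) * D + eps.
Proof.
move=> b01 div c0 sD rec tail thn.
have [Nn Lsum] := sum_ge_rate_of_divergence b01 div thn.
have N1n : (N.+1 <= n)%N by lia.
have s0 i : 0 <= s i by case/andP: (sD i).
have := @contraction_recurrence_bound _ s (b \o S) c N.+1 (n - N.+1)
  (fun i => b01 i.+1) s0 c0 rec.
move=> /le_trans; rewrite subnKC //; apply.
have := tail (n - N.+1)%N; rewrite subnKC // => ?.
apply: lerD => //; apply: ler_pM; rewrite ?expR_ge0 //.
  by move: Lsum; rewrite addn2 big_add1 ler_expR lerN2.
by case/andP: (sD N.+1).
Qed.

(** * The Tikhonov-Mann iteration *)

Lemma convex_comb_le (R : realDomainType) (l a b r : R) :
  0 <= l <= 1 -> a <= r -> b <= r -> (1 - l) * a + l * b <= r.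
Proof. by case/andP=> l0 l1 ar br; nra. Qed.

Section TikhonovMann.
Context {R : realType} {X : metricType R} {W : X -> X -> R -> X}.
Context (HW : Whyperbolic W) {C : set X} (HC : Wconvex W C) {T : X -> X}.
Context (TC : forall y, C y -> C (T y)) (HT : nonexpansive_on C T).
Context {p : X} (Hp : Fix C T p) {x0 u : X} (Hx0 : C x0) (Hu : C u).
Context {lam beta : nat -> R} (Hlam : forall n, 0 <= lam n <= 1).
Context (Hbeta : forall n, 0 <= beta n <= 1).
Context {M : R} (x0p : mdist p x0 <= M) (up : mdist p u <= M).

Local Notation x := (tikhonov_mann W T u x0 lam beta).
Local Notation v n := (W u (x n) (beta n)).

Lemma mdist_W_le (y z w : X) (r l : R) : 0 <= l <= 1 ->
  mdist y z <= r -> mdist y w <= r -> mdist y (W z w l) <= r.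
Proof.
move=> l01 zr wr; apply: le_trans (W1 HW z w y l01) _.
exact: convex_comb_le.
Qed.

(** Nonexpansiveness against [p = T p] keeps the iteration in the ball around
    [p]. *)
Lemma mdist_Fix_le (y : X) : C y -> mdist p (T y) <= mdist p y.
Proof. by case: Hp => Cp Tp Cy; rewrite -{1}Tp; exact: HT. Qed.

Lemma tikhonov_mann_mem (n : nat) : C (x n).
Proof.
case: HC => _ Wcl; elim: n => [//|n IHn] /=.
have Cv : C (v n) by exact: Wcl.
by apply: Wcl => //; exact: TC.
Qed.

Lemma anchor_mem (n : nat) : C (v n).
Proof. by case: HC => _ Wcl; apply: Wcl => //; exact: tikhonov_mann_mem. Qed.

Lemma tikhonov_mann_bounded (n : nat) : mdist p (x n) <= M.
Proof.
elim: n => [//|n IHn] /=.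
have vM : mdist p (v n) <= M by exact: mdist_W_le.
apply: mdist_W_le => //; apply: le_trans vM; apply: mdist_Fix_le.
exact: anchor_mem.
Qed.

Lemma anchor_bounded (n : nat) : mdist p (v n) <= M.
Proof. by apply: mdist_W_le => //; exact: tikhonov_mann_bounded. Qed.

Lemma mdist_le_diameter (y z : X) : mdist p y <= M -> mdist p z <= M ->
  mdist y z <= 2 * M.
Proof.
move=> yM zM; have := metric_triangle y p z; rewrite (metric_sym y p); lra.
Qed.

Lemma tikhonov_mann_step_bounded (n : nat) : mdist (x n) (x n.+1) <= 2 * M.
Proof. by apply: mdist_le_diameter; exact: tikhonov_mann_bounded. Qed.

(** The intermediate point combines [u] and [x n] with the new coefficient
    [beta n.+1]; it shares [u] with the second point, hence the factor
    [beta n.+1] which makes the recurrence contract. *)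
Lemma anchor_step (n : nat) :
  mdist (v n) (v n.+1) <=
  beta n.+1 * mdist (x n) (x n.+1) + 2 * M * `|beta n.+1 - beta n|.
Proof.
apply: le_trans (metric_triangle _ (W u (x n) (beta n.+1)) _) _.
rewrite [leLHS]addrC lerD //.
  apply: le_trans (W4 HW _ _ _ _ (Hbeta n.+1)) _.
  by rewrite mdistxx mulr0 add0r.
rewrite (W2 HW) // distrC mulrC ler_wpM2r //.
by apply: mdist_le_diameter => //; exact: tikhonov_mann_bounded.
Qed.

(** The factor is written [1 - (1 - beta n.+1)] because it is the series of the
    [1 - beta n] that is assumed to diverge. *)
Lemma tikhonov_mann_step (n : nat) :
  mdist (x n.+1) (x n.+2) <=
  (1 - (1 - beta n.+1)) * mdist (x n) (x n.+1)
  + 2 * M * (`|beta n.+1 - beta n| + `|lam n.+1 - lam n|).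
Proof.
rewrite subKr mulrDr addrA.
apply: le_trans (metric_triangle _ (W (v n) (T (v n)) (lam n.+1)) _) _.
rewrite [leLHS]addrC lerD //.
  apply: le_trans _ (anchor_step n).
  apply: le_trans (W4 HW _ _ _ _ (Hlam n.+1)) _.
  have vv := HT (anchor_mem n) (anchor_mem n.+1).
  exact: (convex_comb_le (Hlam n.+1) (lexx _) vv).
rewrite (W2 HW) // distrC mulrC ler_wpM2r //.
have vM := anchor_bounded n; apply: mdist_le_diameter => //.
by apply: le_trans vM; apply: mdist_Fix_le; exact: anchor_mem.
Qed.

(** (W1) at [T (x n)], with [d (T x_n, u_n) <= d (x_n, T x_n) + d (x_n, u_n)] and
    [d (T x_n, T u_n) <= d (x_n, u_n)], bounds [d (x_{n+1}, T x_n)] by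
    [(1 - lam_n) d (x_n, T x_n) + d (x_n, u_n)]: only a fraction of the residual
    reappears, and moving it to the left leaves [lam n] times the residual. *)
Lemma tikhonov_mann_residual (n : nat) :
  lam n * mdist (x n) (T (x n)) <=
  mdist (x n) (x n.+1) + 2 * M * (1 - beta n).
Proof.
have Cx := tikhonov_mann_mem n; have Cv := anchor_mem n.
have xu : mdist (x n) u <= 2 * M.
  by apply: mdist_le_diameter => //; exact: tikhonov_mann_bounded.
have xv : mdist (x n) (v n) <= 2 * M * (1 - beta n).
  apply: le_trans (W1 HW _ _ _ (Hbeta n)) _.
  rewrite mdistxx mulr0 addr0 mulrC ler_wpM2r // subr_ge0.
  by case/andP: (Hbeta n).
have tri := metric_triangle (x n) (x n.+1) (T (x n)).
have xT : mdist (x n.+1) (T (x n)) <=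
          (1 - lam n) * mdist (T (x n)) (v n)
          + lam n * mdist (T (x n)) (T (v n)).
  by rewrite metric_sym /=; exact: W1.
have Txv := metric_triangle (T (x n)) (x n) (v n).
rewrite (metric_sym (T (x n)) (x n)) in Txv.
case/andP: (Hlam n) => l0 l1; have l1' : 0 <= 1 - lam n by rewrite subr_ge0.
have := ler_wpM2l l0 (HT Cx Cv); have := ler_wpM2l l1' Txv.
lra.
Qed.

End TikhonovMann.

(** * Rates of asymptotic regularity *)

Theorem theorem4p1 (R : realType) (X : metricType R) (W : X -> X -> R -> X)
  (HW : Whyperbolic W)
  (C : set X) (HC : Wconvex W C)
  (T : {fun C >-> C}) (HT : nonexpansive_on C T) (HFix : Fix C T !=set0)
  (x0 u : X) (Hx0 : C x0) (Hu : C u)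
  (lam beta : nat -> R)
  (Hlam : forall n, 0 <= lam n <= 1) (Hbeta : forall n, 0 <= beta n <= 1)
  (sigma1 sigma3 sigma4 : nat -> nat)
  (Hsigma1 : series_diverges_with (fun n => 1 - beta n) sigma1)
  (Hsigma3 : series_converges_with (fun n => `|beta n.+1 - beta n|) sigma3)
  (Hsigma4 : series_converges_with (fun n => `|lam n.+1 - lam n|) sigma4)
  (p : X) (Hp : Fix C T p)
  (K : nat) (HK0 : (0 < K)%N)
  (HKM : Num.max (mdist x0 p) (mdist u p) <= K%:R) :
  let x := tikhonov_mann W T u x0 lam beta in
  let chi := fun k : nat =>
    maxn (sigma3 (8 * K * (k + 1) - 1)%N) (sigma4 (8 * K * (k + 1) - 1)%N) in
  let Sigma := fun k : nat =>
    (sigma1 (chi (3 * k + 2) + 2 + ceil_ln R (6 * K * (k + 1))) + 1)%N in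
  asymptotically_regular_with x Sigma /\
  (forall (sigma5 : nat -> nat) (Lam N : nat),
    converges_with (beta : nat -> R^o) 1 sigma5 ->
    (0 < Lam)%N ->
    (forall n : nat, (N <= n)%N -> Lam%:R^-1 <= lam n) ->
    T_asymptotically_regular_with T x (fun k : nat =>
      maxn N (maxn (Sigma (2 * Lam * (k + 1) - 1)%N)
                   (sigma5 (4 * K * Lam * (k + 1) - 1)%N)))).
Proof.
move=> x chi Sigma.
have TC : forall y, C y -> C (T y) by exact: funS.
move: HKM; rewrite ge_max (metric_sym x0) (metric_sym u) => /andP[x0K uK].
have K0 : (0 : R) < K%:R by rewrite ltr0n.
pose s n := mdist (x n) (x n.+1).
pose c n : R := 2 * K%:R * (`|beta n.+1 - beta n| + `|lam n.+1 - lam n|).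
have s_bounds n : 0 <= s n <= 2 * K%:R.
  rewrite mdist_ge0 /=.
  exact: (tikhonov_mann_step_bounded HW HC TC HT Hp Hx0 Hu Hlam Hbeta x0K uK).
have s_rec n : s n.+1 <= (1 - (1 - beta n.+1)) * s n + c n.
  exact: (tikhonov_mann_step HW HC TC HT Hp Hx0 Hu Hlam Hbeta x0K uK).
have c0 n : 0 <= c n by rewrite !mulr_ge0 ?addr_ge0.
have s_rate k n : (Sigma k <= n)%N -> s n <= k.+1%:R^-1.
  move=> kn; pose j := (8 * K * (3 * k + 2 + 1) - 1)%N.
  have tail m : \sum_((chi (3 * k + 2)%N).+1 <= i < (chi (3 * k + 2)%N).+1 + m)
      c i <= 2 * K%:R * (j.+1%:R^-1 + j.+1%:R^-1).
    rewrite -mulr_sumr big_split /= ler_wpM2l ?mulr_ge0 // lerD //.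
      by apply: sum_tail_le (proj2 Hsigma3) _; exact: leq_maxl.
    by apply: sum_tail_le (proj2 Hsigma4) _; exact: leq_maxr.
  have b01 i : 0 <= 1 - beta i <= 1.
    by case/andP: (Hbeta i) => b0 b1; rewrite subr_ge0 b1 lerBlDr lerDl b0.
  have := contraction_recurrence_rate b01 (proj2 Hsigma1) c0 s_bounds s_rec tail
    (leq_trans (leq_addr _ _) kn).
  move=> /le_trans; apply.
  have L0 : (0 < 6 * K * (k + 1))%N by lia.
  have KE : expR (- (ceil_ln R (6 * K * (k + 1)))%:R) * (2 * K%:R)
            <= (6 * K * (k + 1))%:R^-1 * (2 * K%:R) :> R.
    by rewrite ler_wpM2r ?mulr_ge0 //; exact: expR_ceil_ln.
  apply: le_trans (lerD KE (lexx _)) _.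
  (* The exponential part is at most [1 / (3 (k + 1))], and the two tails
     contribute [1 / (12 (k + 1))] each. *)
  have -> : j.+1 = (24 * K * k.+1)%N by rewrite /j; lia.
  have k0 : (0 : R) < k.+1%:R by rewrite ltr0n.
  rewrite addn1 !natrM.
  have -> : (6%:R * K%:R * k.+1%:R)^-1 * (2 * K%:R)
      + 2 * K%:R * ((24%:R * K%:R * k.+1%:R)^-1 + (24%:R * K%:R * k.+1%:R)^-1)
      = k.+1%:R^-1 / 2 :> R by field; rewrite !gt_eqF.
  by rewrite ler_pdivrMr // ler_peMr ?invr_ge0 ?ler0n // ler1n.
split; first by apply: converges_with0 => // n; exact: mdist_ge0.
move=> sigma5 Lam N [_ beta_rate] Lam0 lamN.
have Lam_gt0 : (0 : R) < Lam%:R by rewrite ltr0n.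
apply: converges_with0 => [n|k n]; first exact: mdist_ge0.
rewrite !geq_max => /and3P[Nn Sn bn].
have := s_rate _ _ Sn; have := beta_rate _ _ bn.
rewrite mdist_absE distrC ger0_norm; last first.
  by rewrite subr_ge0; case/andP: (Hbeta n).
have -> : ((2 * Lam * (k + 1) - 1).+1 = 2 * Lam * k.+1)%N by lia.
have -> : ((4 * K * Lam * (k + 1) - 1).+1 = 4 * K * Lam * k.+1)%N by lia.
have res := tikhonov_mann_residual HW HC TC HT Hp Hx0 Hu Hlam Hbeta x0K uK n.
rewrite -/x -/(s n) in res *; rewrite !natrM => b_le s_le.
have k0 : (0 : R) < k.+1%:R by rewrite ltr0n.
have lamres : Lam%:R^-1 * mdist (x n) (T (x n)) <= Lam%:R^-1 * k.+1%:R^-1.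
  apply: le_trans (ler_wpM2r (mdist_ge0 _ _) (lamN n Nn)) _.
  apply: le_trans res _.
  (* Both parts of the residual bound are at most half of
     [1 / (Lam (k + 1))]. *)
  have -> : Lam%:R^-1 * k.+1%:R^-1 =
      (2%:R * Lam%:R * k.+1%:R)^-1
      + 2 * K%:R * (4%:R * K%:R * Lam%:R * k.+1%:R)^-1 :> R.
    by field; rewrite !gt_eqF.
  by rewrite lerD // ler_wpM2l ?mulr_ge0.
by rewrite ler_pM2l ?invr_gt0 in lamres.
Qed.
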